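(* Let $(m_n)_{n\ge 1}$ be a sequence of positive integers, write $m=m_n$, and for each $n$ let $X=(X_{ij})_{1\le i,j\le n}$ be a random matrix with joint multinomial distribution $\mathcal{M}(m,n^2)$. Assume that $1\ll m\ll n$, i.e. $m_n\to\infty$ and $m_n/n\to0$ as $n\to\infty$. Then, as $n\to\infty$, $$\mathbb{E}\max_{\sigma\in\mathcal{S}_n}\sum_{i=1}^n X_{i\sigma(i)}=m\,(1+o(1)).$$
   Context: $\mathcal{S}_n$ denotes the group of permutations of $\{1,\dots,n\}$. $\mathcal{M}(m,N)$ denotes the multinomial law with $m$ trials and $N$ equiprobable cells: it is the law of the vector of cell counts when $m$ particles are thrown independently and uniformly into $N$ cells. Under $\mathcal{M}(m,n^2)$ the cells are the $n^2$ positions $(i,j)$ of the matrix, so each $X_{ij}$ has the binomial distribution with $m$ trials and success probability $n^{-2}$, and $\sum_{i,j}X_{ij}=m$. *)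

(* Defs.v *)
From HB Require Import structures.
From mathcomp Require Import all_boot all_order all_algebra all_fingroup.
From mathcomp Require Import all_classical all_reals all_analysis.

Set Implicit Arguments.
Unset Strict Implicit.
Unset Printing Implicit Defensive.

Import Order.TTheory GRing.Theory Num.Theory.
Import numFieldNormedType.Exports.

Local Open Scope classical_set_scope.
Local Open Scope ring_scope.

Definition cell_counts (m : nat) (C : finType) (f : {ffun 'I_m -> C}) :
    {ffun C -> nat} :=
  [ffun c => #|[set a : 'I_m | f a == c]%SET|].

(* Throwing [m] particles independently and uniformly into the cells [C] is
   the uniform law on the [#|C| ^ m] placements [{ffun 'I_m -> C}]; this is the
   mass that the induced law of the vector of cell counts gives to [k]. *)
Definition multinomial_mass (R : realType) (m : nat) (C : finType)
    (k : {ffun C -> nat}) : R :=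
  #|[set f : {ffun 'I_m -> C} | cell_counts f == k]%SET|%:R
    / #|C|%:R ^+ m.

(* The entries take values in the countable type [nat], so the joint law is
   determined by the masses of the singletons [k]. *)
Definition multinomial_matrix (R : realType) (d : measure_display)
    (T : measurableType d) (P : probability T R) (m n : nat)
    (X : 'I_n -> 'I_n -> {RV P >-> nat}) : Prop :=
  forall k : {ffun 'I_n * 'I_n -> nat},
    P [set w | forall i j, X i j w = k (i, j)] = (multinomial_mass R m k)%:E.

Definition max_assignment (n : nat) (x : 'I_n -> 'I_n -> nat) : nat :=
  (\max_(s : 'S_n) \sum_(i < n) x i (s i))%N.

(* Main.v *)
Require Import Defs.
From HB Require Import structures.
From mathcomp Require Import all_boot all_order all_algebra all_fingroup.
From mathcomp Require Import all_classical all_reals all_analysis.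
From mathcomp Require Import measurable_realfun.
Import Order.TTheory GRing.Theory Num.Theory.
Import numFieldNormedType.Exports.
Local Open Scope classical_set_scope.
Local Open Scope ring_scope.

(** The maximum counts at most the [m] balls thrown, so only a lower bound on the
mean is at stake.  When [m] is much smaller than [n], most balls are alone both
in their row and in their column.  The cells of these isolated balls have
pairwise distinct rows and pairwise distinct columns, so a single permutation
passes through all of them ([injective_extends_perm]), and the maximal assignment
is at least the number of isolated balls ([max_assignment_ge_isolated]).

A given pair of balls shares a row with probability [1 / n], and likewise a
column ([card_collision]).  By the union bound over the fewer than [m ^ 2]
ordered pairs, the mean number of balls that are not isolated is at most
[2 * m ^ 2 / n] ([sum_crowded_balls]).  Hence the mean of the maximum lies between
[m * (1 - 2 * m / n)] and [m], and [m / n] tends to 0.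

The counting is done over the finite set of placements of the [m] balls; the
link with the random matrix is [expectation_multinomial], by which the expectation
of a function of the matrix is its average over these placements. *)

(** Induction on [B]: once the other points of [B] are handled by [s], composing
with the transposition of [s (r x)] and [c x] corrects the value at [r x] and,
by the two injectivity hypotheses, moves none of the values already right. *)
Lemma injective_extends_perm (I T : finType) (B : {set I}) (r c : I -> T) :
  {in B &, injective r} -> {in B &, injective c} ->
  exists s : {perm T}, {in B, forall a, s (r a) = c a}.
Proof.
have [k] := ubnP #|B|; elim: k => // k IHk in B *; rewrite ltnS => leBk rI cI.
have [->|[x xB]] := set_0Vmem B; first by exists 1%g => a; rewrite inE.
have sub : {subset B :\ x <= B} by move=> y; rewrite !inE => /andP[].
have [|||s sE] := IHk (B :\ x)%SET.
- by rewrite (leq_trans _ leBk) // [in leqRHS](cardsD1 x) xB.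
- by move=> a b aB bB; apply: rI; apply: sub.
- by move=> a b aB bB; apply: cI; apply: sub.
exists (s * tperm (s (r x)) (c x))%g => a aB; rewrite permM.
have [->|ax] := eqVneq a x; first by rewrite tpermL.
have -> : s (r a) = c a by rewrite sE // !inE ax.
have -> // : tperm (s (r x)) (c x) (c a) = c a.
rewrite tpermD // eq_sym.
  have <- : s (r a) = c a by rewrite sE // !inE ax.
  by rewrite (inj_eq perm_inj); apply: contra_neq ax => /rI->.
by apply: contra_neq ax => /cI->.
Qed.

(** Grouping the balls by row turns the sum of the counts along the graph of [s]
into a number of balls, the form in which both bounds on the maximum are read. *)
Lemma sum_cell_counts (m n : nat) (f : {ffun 'I_m -> 'I_n * 'I_n}) (s : 'S_n) :
  (\sum_(i < n) cell_counts f (i, s i) = #|[set a | s (f a).1 == (f a).2]%SET|)%N.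
Proof.
rewrite -sum1_card (partition_big (fun a => (f a).1) xpredT) //=.
apply: eq_bigr => i _; rewrite ffunE -sum1_card.
apply: eq_bigl => a; rewrite !inE; case: (f a) => x y /=.
by rewrite xpair_eqE andbC; case: (eqVneq x i) => [->|]; rewrite ?andbT ?andbF // eq_sym.
Qed.

Lemma card_placements_gt0 (m n : nat) :
  (0 < n)%N -> (0 < #|{ffun 'I_m -> 'I_n * 'I_n}|)%N.
Proof.
by move=> n_gt0; rewrite card_ffun expn_gt0 card_prod !card_ord muln_gt0 n_gt0.
Qed.

Definition isolated_balls {m n : nat} (f : {ffun 'I_m -> 'I_n * 'I_n}) : {set 'I_m} :=
  [set a | [forall b, (b != a) ==> ((f b).1 != (f a).1) && ((f b).2 != (f a).2)]]%SET.

Lemma max_assignment_ge_isolated (m n : nat) (f : {ffun 'I_m -> 'I_n * 'I_n}) :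
  (#|isolated_balls f| <= max_assignment (fun i j => cell_counts f (i, j)))%N.
Proof.
have iso a b : a \in isolated_balls f -> b != a ->
    (f b).1 != (f a).1 /\ (f b).2 != (f a).2.
  by rewrite inE => /forallP/(_ b)/implyP h /h /andP.
have [||s sE] := injective_extends_perm _ _ (isolated_balls f)
    (fun a => (f a).1) (fun a => (f a).2).
- move=> a b _ bB eab; apply/eqP; apply: contraTT isT => nab.
  by have [] := iso _ _ bB nab; rewrite eab eqxx.
- move=> a b _ bB eab; apply/eqP; apply: contraTT isT => nab.
  by have [_] := iso _ _ bB nab; rewrite eab eqxx.
apply: leq_trans (leq_bigmax s); rewrite sum_cell_counts; apply: subset_leq_card.
by apply/fintype.subsetP => a aB; rewrite inE sE.
Qed.

Lemma max_assignment_le_balls (m n : nat) (f : {ffun 'I_m -> 'I_n * 'I_n}) :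
  (max_assignment (fun i j => cell_counts f (i, j)) <= m)%N.
Proof.
apply/bigmax_leqP => s _; rewrite sum_cell_counts.
by rewrite -[leqRHS](card_ord m) max_card.
Qed.

(** The event that two given objects agree in one coordinate has probability at
most [1 / #|L|].  Rewriting that coordinate of the object [b] by an arbitrary
[l : L] embeds [L] times the event into all functions: [l] is read off the new
value at [b], and the old coordinate is recovered from the object [a].  The
accessor [get] and the modifier [set] form a lens, which lets the same count
serve for rows and for columns. *)
Lemma card_collision (I C L : finType) (get : C -> L) (set : C -> L -> C)
    (a b : I) :
  (forall x l, get (set x l) = l) -> (forall x l, set (set x l) (get x) = x) ->
  b != a ->
  (#|L| * #|[set f : {ffun I -> C} | get (f b) == get (f a)]%SET|
   <= #|{ffun I -> C}|)%N.
Proof.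
move=> getK setK ba; pose S := [set f : {ffun I -> C} | get (f b) == get (f a)]%SET.
pose h (u : L * {ffun I -> C}) : {ffun I -> C} :=
  [ffun i => if i == b then set (u.2 b) u.1 else u.2 i].
rewrite -cardsT -cardsX -(@card_in_imset _ _ h); first exact: max_card.
move=> [l f] [l' g]; rewrite !inE /= => /eqP fS /eqP gS /ffunP hE.
have fg i : i != b -> f i = g i.
  by move=> /negbTE ib; have := hE i; rewrite !ffunE ib.
have := hE b; rewrite !ffunE eqxx /= => eb.
have <- : l = l' by rewrite -(getK (f b) l) eb getK.
congr (_, _); apply/ffunP => i; have [->|/fg//] := eqVneq i b.
have gE : get (f b) = get (g b) by rewrite fS gS fg // eq_sym.
by rewrite -(setK (f b) l) eb gE setK.
Qed.

(** Union bound: a ball which is not isolated shares its row or its column with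
some other ball, so the number of such balls is at most the number of
coincidences over ordered pairs of distinct balls, each of which happens for at
most a fraction [1 / n] of the placements. *)
Lemma sum_crowded_balls (m n : nat) :
  (n * \sum_(f : {ffun 'I_m -> 'I_n * 'I_n}) #|~: isolated_balls f|
   <= 2 * m ^ 2 * #|{ffun 'I_m -> 'I_n * 'I_n}|)%N.
Proof.
pose row_hit (a b : 'I_m) (f : {ffun 'I_m -> 'I_n * 'I_n}) : bool :=
  (f b).1 == (f a).1.
pose col_hit (a b : 'I_m) (f : {ffun 'I_m -> 'I_n * 'I_n}) : bool :=
  (f b).2 == (f a).2.
have bad f : (#|~: isolated_balls f| <=
    \sum_a \sum_(b | b != a) (row_hit a b f + col_hit a b f))%N.
  rewrite -sum1_card big_mkcond /=; apply: leq_sum => a _.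
  rewrite !inE; case: ifP => // /forallPn[b]; rewrite negb_imply => /andP[ba].
  rewrite (bigD1 b) //= negb_and !negbK /row_hit /col_hit.
  by case/orP => ->; rewrite ?addnS.
apply: (@leq_trans (n * \sum_(f : {ffun 'I_m -> 'I_n * 'I_n})
    \sum_a \sum_(b | b != a) (row_hit a b f + col_hit a b f))).
  by rewrite leq_mul2l leq_sum ?orbT.
rewrite exchange_big big_distrr /=.
under eq_bigr => a _ do rewrite exchange_big big_distrr /=.
have pair a b : b != a ->
    (n * \sum_f (row_hit a b f + col_hit a b f)
     <= 2 * #|{ffun 'I_m -> 'I_n * 'I_n}|)%N.
  move=> ba; rewrite big_split mulnDr mul2n -addnn leq_add //=.
    have := card_collision 'I_m ('I_n * 'I_n)%type 'I_n fst (fun x l => (l, x.2)) a b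
      (fun=> fun=> erefl) (fun '(_, _) => fun=> erefl) ba.
    by rewrite card_ord -sum1_card big_mkcond; under eq_bigr do rewrite inE.
  have := card_collision 'I_m ('I_n * 'I_n)%type 'I_n snd (fun x l => (x.1, l)) a b
    (fun=> fun=> erefl) (fun '(_, _) => fun=> erefl) ba.
  by rewrite card_ord -sum1_card big_mkcond; under eq_bigr do rewrite inE.
apply: (@leq_trans (\sum_(a < m) \sum_(b < m) 2 * #|{ffun 'I_m -> 'I_n * 'I_n}|)).
  apply: leq_sum => a _; rewrite [leqRHS](bigID (fun b => b != a)) /=.
  by apply: leq_trans (leq_addr _ _); apply: leq_sum => b /pair.
by rewrite !sum_nat_const card_ord; apply/eq_leq; rewrite mulnA mulnn mulnCA mulnA.
Qed.
Lemma sum_max_assignment_le (m n : nat) :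
  (\sum_(f : {ffun 'I_m -> 'I_n * 'I_n})
     max_assignment (fun i j => cell_counts f (i, j))
   <= m * #|{ffun 'I_m -> 'I_n * 'I_n}|)%N.
Proof.
rewrite mulnC -sum_nat_const; apply: leq_sum => f _.
exact: max_assignment_le_balls.
Qed.

Lemma sum_max_assignment_ge (m n : nat) :
  (n * (m * #|{ffun 'I_m -> 'I_n * 'I_n}|)
   <= n * \sum_(f : {ffun 'I_m -> 'I_n * 'I_n})
          max_assignment (fun i j => cell_counts f (i, j))
      + 2 * m ^ 2 * #|{ffun 'I_m -> 'I_n * 'I_n}|)%N.
Proof.
apply: leq_trans (leq_add (leqnn _) (sum_crowded_balls m n)).
rewrite -mulnDr leq_mul2l -big_split mulnC -sum_nat_const /=.
rewrite leq_sum ?orbT// => f _.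
by rewrite -[leqLHS](card_ord m) -(cardsC (isolated_balls f)) leq_add2r
  max_assignment_ge_isolated.
Qed.

(** The values of [c] are listed without repetition, since [K] need not be
finite; it is used with [K] the type of all count matrices. *)
Lemma sum_undup_codom (R : realType) (F : finType) (K : eqType) (c : F -> K)
    (g : K -> R) :
  \sum_(k <- undup (codom c)) g k * #|[set f | c f == k]%SET|%:R = \sum_f g (c f).
Proof.
transitivity (\sum_(k <- undup (codom c)) \sum_(f | c f == k) g (c f)).
  apply: eq_bigr => k _; rewrite -sum1_card natr_sum big_distrr /=.
  rewrite (eq_bigl (fun f => c f == k)) => [|f]; last by rewrite inE.
  by apply: eq_bigr => f /eqP->; rewrite mulr1.
rewrite (exchange_big_dep predT) //=; apply: eq_bigr => f _.
rewrite (eq_bigl (pred1 (c f))) => [|k]; last by rewrite /= eq_sym.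
by rewrite -big_filter filter_pred1_uniq ?undup_uniq ?big_seq1 // mem_undup codom_f.
Qed.

(** The matrix takes almost surely one of the finitely many values that are count
matrices of placements, because the masses of these values already add up to 1.
On this event the integral is a finite sum, which regrouped by placement is an
average. *)
Lemma expectation_multinomial (R : realType) (d : measure_display)
    (T : measurableType d) (P : probability T R) (m n : nat)
    (X : 'I_n -> 'I_n -> {RV P >-> nat}) (h : {ffun 'I_n * 'I_n -> nat} -> R) :
  (0 < n)%N -> multinomial_matrix m X -> (forall k, 0 <= h k) ->
  ('E_P[fun w => h [ffun c => X c.1 c.2 w]])%E =
  ((\sum_(f : {ffun 'I_m -> 'I_n * 'I_n}) h (cell_counts f))
    / #|{ffun 'I_m -> 'I_n * 'I_n}|%:R)%:E.
Proof.
move=> n_gt0 law h_ge0; rewrite unlock.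
pose Y w : {ffun 'I_n * 'I_n -> nat} := [ffun c => X c.1 c.2 w].
pose A k := [set w | Y w = k].
have AE k : A k = [set w | forall i j, X i j w = k (i, j)].
  apply/seteqP; split => w /=.
    by move=> /ffunP Yk i j; have := Yk (i, j); rewrite ffunE.
  by move=> Xk; apply/ffunP => -[i j]; rewrite ffunE Xk.
have mA k : measurable (A k).
  rewrite (_ : A k = \bigcap_(c in [set: 'I_n * 'I_n]) (X c.1 c.2 @^-1` [set k c])).
    by apply: fin_bigcap_measurable => // c _; exact: measurable_funPTI.
  rewrite AE; apply/seteqP; split => w /=; first by move=> Xk [i j] _; exact: Xk.
  by move=> Xk i j; exact: (Xk (i, j)).
(* Countably many matrices are possible, so any function of the matrix is
   measurable. *)
have mh (g : {ffun 'I_n * 'I_n -> nat} -> R) :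
    measurable_fun setT (fun w => g (Y w)).
  move=> _ B _; rewrite setTI.
  rewrite (_ : _ @^-1` _ = \bigcup_k (if g k \in B then A k else set0)).
    apply: countable_bigcupT_measurable => [|k]; last by case: ifP.
    exact: countableP.
  apply/seteqP; split => w /=.
    by move=> Bw; exists (Y w) => //; rewrite mem_set.
  by case=> k _; case: ifPn => // /set_mem Bk; rewrite /A /= => ->.
pose s := undup (codom (@cell_counts m ('I_n * 'I_n)%type)).
pose D := \big[setU/set0]_(k <- s) A k.
have mD : measurable D by apply: bigsetU_measurable.
have N_gt0 := card_placements_gt0 m n n_gt0.
have intD (g : {ffun 'I_n * 'I_n -> nat} -> R) : (forall k, 0 <= g k) ->
    (\int[P]_(w in D) (g (Y w))%:E)%E =
    ((\sum_(f : {ffun 'I_m -> 'I_n * 'I_n}) g (cell_counts f))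
      / #|{ffun 'I_m -> 'I_n * 'I_n}|%:R)%:E.
  move=> g_ge0; rewrite ge0_integral_bigsetU //; last 4 first.
  - exact: undup_uniq.
  - by move=> k l _ _ [w []]; rewrite /A /= => -> ->.
  - by apply/measurable_EFinP; exact: measurable_funTS (mh g).
  - by move=> w _; rewrite lee_fin.
  rewrite -sum_undup_codom big_distrl -sumEFin; apply: eq_bigr => k _ /=.
  rewrite (eq_integral (cst (g k)%:E)); last by move=> w /set_mem <-.
  transitivity ((g k)%:E * P (A k))%E; first by rewrite integral_cst.
  rewrite AE law /multinomial_mass -EFinM mulrA.
  by rewrite card_ffun card_ord natrX.
(* The constant function 1 in [intD] shows that [D] has full measure. *)
have PD : P D = 1%E.
  have := intD (fun=> 1) (fun=> ler01); rewrite sumr_const divff ?pnatr_eq0 -?lt0n //.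
  by rewrite integral_cst // mul1e.
rewrite -intD // (@ge0_negligible_integral _ _ _ _ setT (~` D)) ?setDE ?setCK ?setTI//.
- exact: measurableC.
- by apply/measurable_EFinP; exact: mh.
- by move=> w _; rewrite lee_fin.
- transitivity (P (~` D)) => //; by rewrite probability_setC // PD subee.
Qed.

Theorem theorem8 (R : realType) (m : nat -> nat)
    (d : nat -> measure_display) (T : forall n : nat, measurableType (d n))
    (P : forall n : nat, probability (T n) R)
    (X : forall n : nat, 'I_n -> 'I_n -> {RV (P n) >-> nat})
    (m_gt0 : forall n : nat, (0 < n)%N -> (0 < m n)%N)
    (X_law : forall n : nat, (0 < n)%N -> multinomial_matrix (m n) (X n))
    (m_infty : m n @[n --> \oo] --> \oo)
    (m_small : (m n)%:R / n%:R @[n --> \oo] --> (0 : R)) :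
  exists eps : nat -> R,
    eps n @[n --> \oo] --> (0 : R) /\
    forall n : nat, (0 < n)%N ->
      ('E_(P n)[fun w : T n => (max_assignment (fun i j => X n i j w))%:R%R])%E
      = ((m n)%:R * (1 + eps n))%:E.
Proof.
pose C n := {ffun 'I_(m n) -> 'I_n * 'I_n}.
pose S n := (\sum_(f : C n) max_assignment (fun i j => cell_counts f (i, j)))%N.
pose mean n : R := (S n)%:R / #|C n|%:R.
have mean_bounds n : (0 < n)%N ->
    (m n)%:R - 2 * (m n)%:R ^+ 2 / n%:R <= mean n <= (m n)%:R.
  move=> n_gt0; have N_gt0 := card_placements_gt0 (m n) n n_gt0.
  rewrite /mean ler_pdivlMr ?ltr0n // ler_pdivrMr ?ltr0n // -natrM ler_nat.
  rewrite sum_max_assignment_le andbT.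
  have n0 : n%:R != 0 :> R by rewrite pnatr_eq0 -lt0n.
  rewrite -(@ler_pM2l _ n%:R) ?ltr0n // mulrA mulrBr.
  rewrite (mulrCA n%:R) divff // mulr1 mulrBl lerBlDr.
  by rewrite -!natrX -!natrM -natrD ler_nat -mulnA sum_max_assignment_ge.
exists (fun n => mean n / (m n)%:R - 1); split; last first.
  move=> n n_gt0; rewrite addrC subrK mulrC divfK; last first.
    by rewrite pnatr_eq0 -lt0n m_gt0.
  pose h (k : {ffun 'I_n * 'I_n -> nat}) : R :=
    (max_assignment (fun i j => k (i, j)))%:R.
  have -> : (fun w : T n => (max_assignment (fun i j => X n i j w))%:R)
      = (fun w => h [ffun c => X n c.1 c.2 w]).
    apply/funext => w; congr (_%:R); apply: eq_bigr => s _.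
    by apply: eq_bigr => i _; rewrite ffunE.
  rewrite (expectation_multinomial _ _ _ _ (m n)) //; last exact: X_law.
  by rewrite /mean /S natr_sum.
apply: (@squeeze_cvgr _ _ _ _ (fun n => - 2 * ((m n)%:R / n%:R)) (fun=> 0)).
- near=> n; have n_gt0 : (0 < n)%N by near: n; exact: nbhs_infty_gt.
  have m0 : 0 < (m n)%:R :> R by rewrite ltr0n m_gt0.
  have /andP[lo hi] := mean_bounds n n_gt0.
  rewrite subr_le0 ler_pdivrMr // mul1r hi andbT.
  rewrite lerBrDr ler_pdivlMr // mulrDl mul1r addrC.
  by apply: le_trans lo; rewrite lerD2l mulNr mulNr lerN2 expr2 !mulrA (mulrAC _ _^-1).
- rewrite -[X in _ --> X](mulr0 (- 2)); exact: cvgMr.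
- exact: cvg_cst.
Unshelve. all: by end_near.
Qed.
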